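(* Let $T$ be a tree and let $\Gamma$ be a countable subgroup of $\operatorname{Aut}(T)$ that contains (two) transverse hyperbolic automorphisms. If $\Gamma$ is inner amenable, then there exists a non-trivial elliptic element of $\Gamma$ that fixes an unbounded subtree of $T$.
   Context: Trees are simplicial (graph-theoretic) trees, with the usual path metric, and $\operatorname{Aut}(T)$ is the group of graph automorphisms. An automorphism of $T$ is elliptic if it fixes at least one vertex of $T$; it is hyperbolic if there is a bi-infinite geodesic, called its axis, on which it induces a translation of non-zero amplitude. Two hyperbolic automorphisms are transverse if their axes have only finitely many (possibly zero) vertices in common. For a group $G$, put $G^*=G\setminus\{1\}$. A (discrete, countable) group $G$ is inner amenable if $G=\{1\}$ or if there is a linear form $m:\ell^\infty(G^* )\to\mathbb{C}$ that is positive ($m(f)\geqslant0$ whenever $f\geqslant 0$), normalized ($m(1)=1$), and invariant under inner automorphisms: $m(f\circ g^{-1})=m(f)$ for all $g\in G$ and $f\in\ell^\infty(G^* )$, where $g$ also denotes the map $x\mapsto gxg^{-1}$ on $G^*$. *)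

(* Defs.v *)
From HB Require Import structures.
From mathcomp Require Import all_boot all_order all_algebra.
From mathcomp Require Import complex.
From mathcomp Require Import all_classical all_reals.
From mathcomp Require Import topology normedtype.
Set Implicit Arguments.
Unset Strict Implicit.
Unset Printing Implicit Defensive.
Import Order.TTheory GRing.Theory Num.Theory.
Import numFieldNormedType.Exports.

Local Open Scope classical_set_scope.
Local Open Scope ring_scope.

(* A closed walk without repeated vertices has length at most 2, the case of
   length 2 being the back and forth along an edge. *)
Record tree := Tree {
  vertex :> eqType;
  adj : rel vertex;
  adj_sym : symmetric adj;
  adj_irr : irreflexive adj;
  tree_nonempty : inhabited vertex;
  tree_connected : forall x y : vertex, exists2 p, path adj x p & last x p = y;
  tree_acyclic : forall c : seq vertex, ucycle adj c -> (size c <= 2)%N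
}.
Arguments adj {t}.

Definition walk (T : tree) (n : nat) (x y : T) : Prop :=
  exists p, [/\ path adj x p, last x p = y & size p = n].

Lemma walk_ex (T : tree) (x y : T) : exists n, `[< walk n x y >].
Proof.
have [p pP pl] := tree_connected x y.
by exists (size p); apply/asboolP; exists p.
Qed.

Definition dist (T : tree) (x y : T) : nat := ex_minn (walk_ex x y).

Record aut (T : tree) := Aut {
  aut_fun :> T -> T;
  aut_inv : T -> T;
  aut_funK : cancel aut_fun aut_inv;
  aut_invK : cancel aut_inv aut_fun;
  aut_adj : forall x y, adj (aut_fun x) (aut_fun y) = adj x y
}.

Section AutGroup.
Variable T : tree.
Implicit Types f g h : aut T.

Lemma aut_eqP f g : (forall x, f x = g x) -> f = g.
Proof.
case: f => f f' fK f'K fE; case: g => g g' gK g'K gE /= /funext e.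
case: _ / e gK g'K gE => gK g'K gE.
have e : f' = g' by apply/funext => x; rewrite -[in LHS](g'K x) fK.
case: _ / e gK g'K => gK g'K.
by congr Aut; exact: Prop_irrelevance.
Qed.

HB.instance Definition _ := gen_eqMixin (aut T).
HB.instance Definition _ := gen_choiceMixin (aut T).

Definition aut_one : aut T :=
  @Aut T id id (fun=> erefl) (fun=> erefl) (fun _ _ => erefl).

Lemma aut_inv_adj f x y : adj (aut_inv f x) (aut_inv f y) = adj x y.
Proof. by rewrite -(aut_adj f) !aut_invK. Qed.

Definition aut_V f : aut T :=
  Aut (@aut_invK T f) (@aut_funK T f) (aut_inv_adj f).

Lemma aut_mul_adj f g x y : adj (f (g x)) (f (g y)) = adj x y.
Proof. by rewrite !aut_adj. Qed.

Definition aut_mul f g : aut T :=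
  @Aut T (f \o g) (aut_inv g \o aut_inv f)
    (can_comp (@aut_funK T f) (@aut_funK T g))
    (can_comp (@aut_invK T g) (@aut_invK T f)) (aut_mul_adj f g).

Lemma aut_mulA : associative aut_mul. Proof. by move=> *; apply: aut_eqP. Qed.
Lemma aut_mul1 : left_id aut_one aut_mul.
Proof. by move=> *; apply: aut_eqP. Qed.
Lemma aut_mulr1 : right_id aut_one aut_mul.
Proof. by move=> *; apply: aut_eqP. Qed.
Lemma aut_mulV : left_inverse aut_one aut_V aut_mul.
Proof. by move=> f; apply: aut_eqP => x /=; exact: aut_funK. Qed.
Lemma aut_mulrV : right_inverse aut_one aut_V aut_mul.
Proof. by move=> f; apply: aut_eqP => x /=; exact: aut_invK. Qed.

HB.instance Definition _ :=
  isGroup.Build (aut T) aut_mulA aut_mul1 aut_mulr1 aut_mulV aut_mulrV.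

End AutGroup.

Section TreeAutomorphisms.
Variable T : tree.
Implicit Types (g h : aut T) (A S : set T).

Definition elliptic g : Prop := exists x : T, g x = x.

Definition geodesic (c : int -> T) : Prop :=
  forall i j : int, dist (c i) (c j) = `|i - j|%N.

Definition is_axis g A : Prop :=
  exists c : int -> T, [/\ geodesic c, A = range c &
    exists2 k : int, k != 0 & forall i, g (c i) = c (i + k)].

Definition hyperbolic g : Prop := exists A, is_axis g A.

(* A hyperbolic automorphism has exactly one axis, so that the quantifiers over
   A and B only serve to name the axes of g and h. *)
Definition transverse g h : Prop :=
  [/\ hyperbolic g, hyperbolic h &
    forall A B, is_axis g A -> is_axis h B -> finite_set (A `&` B)].

(* Since T is a tree, a connected subgraph is an induced subgraph: a subtree is
   determined by its vertex set. *)
Definition subtree S : Prop :=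
  S !=set0 /\ forall x y, S x -> S y ->
    exists p, [/\ path adj x p, last x p = y & forall z, z \in p -> S z].

Definition unbounded S : Prop :=
  forall n : nat, exists x y, [/\ S x, S y & (n < dist x y)%N].

Definition fixes g S : Prop := forall x, S x -> g x = x.

End TreeAutomorphisms.

Record subgroup_type (G : groupType) (H : groupClosed G) := Subgroup {
  subgroup_val : G;
  subgroup_valP : subgroup_val \in H
}.

Section SubgroupType.
Variables (G : groupType) (H : groupClosed G).

Lemma subgroup_closed : group_closed [pred x | x \in H].
Proof. by split=> [|x y]; [exact: gpred1 | exact: gpredF]. Qed.

HB.instance Definition _ := [isSub for @subgroup_val G H].
HB.instance Definition _ := [Choice of subgroup_type H by <:].
HB.instance Definition _ :=
  SubChoice_isSubGroup.Build G _ (subgroup_type H) subgroup_closed.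
End SubgroupType.

Section Linf.
Variables (R : realType) (X : Type).

Definition linf_pred : {pred X -> R[i]} :=
  fun f => `[< bounded_fun (f : X -> R[i]^o) >].

Lemma linf_predP (f : X -> R[i]) :
  reflect (exists M : R[i], M \is Num.real /\ forall x, `|f x| <= M)
          (f \in linf_pred).
Proof.
apply: (iffP (asboolP _)) => [[M [Mreal MP]]|[M [Mreal MP]]].
  exists (M + 1); split; first by rewrite realD// real1.
  by move=> x; apply: (MP (M + 1)) => //; rewrite ltrDl ltr01.
by exists M; split => // N MN x _; exact: le_trans (MP x) (ltW MN).
Qed.

Lemma linf_submod_closed : submod_closed linf_pred.
Proof.
split=> [|a f g].
  by apply/linf_predP; exists 0; split=> [|x]; rewrite ?real0 ?normr0.
move=> /linf_predP[M [Mr MP]] /linf_predP[N [Nr NP]].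
apply/linf_predP; exists (`|a| * M + N).
split; first by rewrite realD// realM// normr_real.
move=> x; apply: le_trans (ler_normD _ _) _.
by rewrite lerD// normrM ler_wpM2l.
Qed.

HB.instance Definition _ :=
  GRing.isSubmodClosed.Build R[i] (X -> R[i]) linf_pred linf_submod_closed.

Record linf := Linf { linf_fun :> X -> R[i]; linfP : linf_fun \in linf_pred }.

HB.instance Definition _ := [isSub for linf_fun].
HB.instance Definition _ := [Choice of linf by <:].
HB.instance Definition _ := [SubChoice_isSubLmodule of linf by <:].

Lemma linf_cst_subproof (a : R[i]) : (fun=> a) \in linf_pred.
Proof. by apply/linf_predP; exists `|a|; rewrite normr_real. Qed.

Definition linf_cst a : linf := Linf (linf_cst_subproof a).

Lemma linf_comp_subproof (f : linf) (h : X -> X) :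
  (fun x => f (h x)) \in linf_pred.
Proof.
have /linf_predP[M [Mr MP]] := linfP f.
by apply/linf_predP; exists M.
Qed.

Definition linf_comp f h : linf := Linf (linf_comp_subproof f h).

End Linf.

Section InnerAmenable.
Variables (R : realType) (G : groupType).

Record nontrivial := Nontrivial { nt_val : G; nt_valP : nt_val != 1%g }.

Lemma inner_subproof (g : G) (x : nontrivial) : (g * nt_val x * g^-1 != 1)%g.
Proof.
apply: contra (nt_valP x) => /eqP e; apply/eqP.
by apply: (mulgI g); apply: (mulIg g^-1%g); rewrite e mulg1 mulgV.
Qed.

Definition inner (g : G) (x : nontrivial) : nontrivial :=
  Nontrivial (inner_subproof g x).

(* The order on R[i] is the partial order in which 0 <= z means that z is a
   nonnegative real number. *)
Definition inner_amenable : Prop :=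
  (forall g : G, g = 1%g) \/
  exists m : {linear linf R nontrivial -> R[i]^o},
    [/\ forall f : linf R nontrivial, (forall x, 0 <= f x) -> 0 <= m f :> R[i],
        m (linf_cst nontrivial 1) = 1 &
        forall (g : G) (f : linf R nontrivial),
          m (linf_comp f (inner g^-1%g)) = m f].

End InnerAmenable.

(* Main.v *)
Require Import Defs.
From HB Require Import structures.
From mathcomp Require Import all_boot all_order all_algebra.
From mathcomp Require Import complex zify.
From mathcomp Require Import all_classical all_reals.
Set Implicit Arguments.
Unset Strict Implicit.
Unset Printing Implicit Defensive.
Local Open Scope classical_set_scope.

(** The theorem is proved in the contrapositive form: if every non-trivial
elliptic element of Gamma has a bounded fixed subtree, then no mean on the
non-trivial elements is invariant under conjugation.

Such an element g attracts every vertex in a canonical way.  If g is elliptic,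
the distance [rho a] from [a] to the farthest fixed vertex is finite, and it
grows in all directions away from the centre of the fixed subtree: [g] points
from [a] to its neighbor [b] when [rho b < rho a].  If g fixes no vertex, g
points from [a] along the first edge of the geodesic from [a] to [g a]; for a
hyperbolic g this is the direction of its attracting end, for an inversion that
of the inverted edge.  Three local rules hold in both cases ([points_in],
[points_uniq], [points_some]): they say that all arrows converge to one place
which is a vertex, an edge or an end.  The family of arrows is equivariant
([points_conj]), and it stands in for this place in the whole argument.

Let c be the axis of a hyperbolic element h of Gamma, and let P be the set of
those g that point outward at neither extremity of some segment of c.  The
place attracting g then projects into this segment, so conjugating by a large
power of h gives a set disjoint from P ([confined_translate]).  Hence P has
three pairwise disjoint conjugates, and its mean is at most 1/3
([disjoint_conjugates_mean]).  For two transverse axes the segments can be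
chosen so long that each axis lies behind both extremities of the segment on the
other
([geodesic_exits]); then no g points outward on both axes ([points_diverge]),
and the two sets of mean at most 1/3 cover everything, which is absurd
([disjoint_conjugates_cover]). *)

(** * Distances in a tree *)
Section TreeMetric.
Variable T : tree.
Implicit Types (x y z a b c u v w o : T) (g : aut T).

Lemma dist_walk x y :
  exists p, [/\ path adj x p, last x p = y & size p = dist x y].
Proof. by rewrite /dist; case: ex_minnP => n /asboolP. Qed.

Lemma dist_le_size x y p : path adj x p -> last x p = y -> dist x y <= size p.
Proof.
move=> xp pl; rewrite /dist; case: ex_minnP => n _; apply.
by apply/asboolP; exists p.
Qed.

Lemma dist0 x y : dist x y = 0 -> x = y.
Proof. by have [[|z p] [_ /= pl <-]] := dist_walk x y. Qed.

Lemma distxx x : dist x x = 0.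
Proof. by apply/eqP; rewrite -leqn0; apply: (@dist_le_size x x [::]). Qed.

Lemma dist_triangle y x z : dist x z <= dist x y + dist y z.
Proof.
have [p [xp pl <-]] := dist_walk x y; have [q [yq ql <-]] := dist_walk y z.
rewrite -size_cat; apply: dist_le_size; last by rewrite last_cat pl.
by rewrite cat_path xp pl.
Qed.

Lemma dist_sym_le x y : dist y x <= dist x y.
Proof.
have [p [xp pl <-]] := dist_walk x y; rewrite -(size_belast x) -size_rev.
apply: dist_le_size.
  by rewrite -pl rev_path (eq_path (e' := adj)) // => a b; rewrite adj_sym.
by case: p xp pl => [_ <-|z p _ _] //=; rewrite rev_cons last_rcons.
Qed.

Lemma dist_sym x y : dist x y = dist y x.
Proof. by apply/eqP; rewrite eqn_leq !dist_sym_le. Qed.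

Lemma adj_dist x y : adj x y -> dist x y <= 1.
Proof. by move=> xy; apply: (@dist_le_size _ _ [:: y]) => //=; rewrite xy. Qed.

Lemma adj_neq x y : adj x y -> x <> y.
Proof. by move=> xy e; rewrite e adj_irr in xy. Qed.

Lemma adj_dist_le x y v : adj x y -> dist x v <= (dist y v).+1.
Proof. by move=> /adj_dist; have := dist_triangle y x v; lia. Qed.

Lemma dist_step x y : x <> y -> exists2 z, adj x z & dist x y = (dist z y).+1.
Proof.
move=> xy; have [[|z p] [/= xp pl sp]] := dist_walk x y; first by case: xy.
have /andP[xz zp] := xp; exists z => //.
have := adj_dist_le y xz; have := dist_le_size zp pl; lia.
Qed.

Lemma dist1_adj x y : dist x y = 1 -> adj x y.
Proof.
move=> d1; have [e|z xz] := @dist_step x y; first by rewrite e distxx in d1.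
by rewrite d1 => -[/esym/dist0 <-].
Qed.

Lemma dist_aut g x y : dist (g x) (g y) = dist x y.
Proof.
have le (f : aut T) a b : dist (f a) (f b) <= dist a b.
  have [p [ap pl <-]] := dist_walk a b; rewrite -(size_map f).
  apply: dist_le_size; last by rewrite last_map pl.
  by rewrite path_map (eq_path (e' := adj)) // => u v /=; rewrite aut_adj.
apply/eqP; rewrite eqn_leq le /= -{1}(aut_funK g x) -{1}(aut_funK g y).
exact: (le (g^-1)%g).
Qed.

(** Acyclicity enters only here: closing the walk up through [b] would give a
cycle of length at least 3. *)
Lemma neighbors_separated a b c p : adj b a -> adj b c -> a <> c ->
  path adj a p -> last a p = c -> b \notin a :: p -> False.
Proof.
move=> ba bc ac ap pl bp; case: (shortenP ap) pl => q aq uq sub ql.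
suff /(tree_acyclic (t := T)) : ucycle adj [:: b, a & q].
  by case: q {aq uq sub} ql => // /ac.
rewrite /ucycle /= ba rcons_path aq ql adj_sym bc /=.
move: uq => /= ->; rewrite andbT; apply: contra bp.
by rewrite !inE => /orP[->//|/sub ->]; rewrite orbT.
Qed.

(** Geodesics from [a] and [c] to [v] avoid [b], and together they join [a] to
[c], against [neighbors_separated].  The asymmetry between the strict and the
large inequality serves to deduce from this single statement both that a tree
is bipartite ([dist_adj_neq]) and that geodesics do not branch
([dist_branch]). *)
Lemma closer_neighbor_unique b a c v : adj b a -> adj b c -> a <> c ->
  (dist a v < dist b v) -> (dist c v <= dist b v) -> False.
Proof.
have avoid n u : adj b u -> dist u v <= dist b v -> dist u v = n ->
    exists p, [/\ path adj u p, last u p = v & b \notin u :: p].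
  move=> bu; elim: n u {bu}(nesym (adj_neq bu)) => [|n IHn] u ub le du.
    exists [::]; split=> //; first by rewrite (dist0 du).
    by rewrite inE eq_sym; apply/eqP.
  have [e|w uw dw] := @dist_step u v; first by rewrite e distxx in du.
  have [wb|||p [wp pl bp]] := IHn w; [|lia|lia|].
    by move: le; rewrite dw wb; lia.
  exists (w :: p); split=> //=; first by rewrite uw.
  by rewrite inE negb_or bp andbT eq_sym; apply/eqP.
move=> ba bc ac av cv.
have [p [ap pl bp]] := avoid _ a ba (ltnW av) erefl.
have [q [cq ql bq]] := avoid _ c bc cv erefl.
apply: (@neighbors_separated a b c (p ++ rev (belast c q))) => //.
- rewrite cat_path ap pl -ql rev_path.
  by rewrite (eq_path (e' := adj)) // => x y; rewrite adj_sym.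
- rewrite last_cat pl -ql.
  by case: q {cq ql bq} => [|z q] //=; rewrite rev_cons last_rcons.
- rewrite -cat_cons mem_cat negb_or bp mem_rev.
  by apply: contra bq => /mem_belast.
Qed.

(** If [a] and [b] were equally far from [v], then [b] and the neighbor of [a]
on the way to [v] would contradict [closer_neighbor_unique]. *)
Lemma dist_adj_neq a b v : adj a b -> dist a v <> dist b v.
Proof.
move=> ab e; have [av|a1 aa1 d1] := @dist_step a v.
  by apply: (adj_neq ab); move: e; rewrite av distxx => /esym/dist0.
apply: (@closer_neighbor_unique a a1 b v) => //; [|lia|lia].
by move=> a1b; rewrite a1b in d1; lia.
Qed.

Lemma dist_adj_cases a b v : adj a b ->
  dist b v = (dist a v).+1 \/ dist a v = (dist b v).+1.
Proof.
move=> ab; have ba : adj b a by rewrite adj_sym.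
have := @dist_adj_neq a b v ab; have := adj_dist_le v ab.
by have := adj_dist_le v ba; lia.
Qed.

(** Uniqueness of geodesics in local form: at most one neighbor of [b] is
closer to [v]. *)
Lemma dist_branch a b c v : adj b a -> adj b c -> a <> c ->
  dist b v < dist a v \/ dist b v < dist c v.
Proof.
move=> ba bc ac; have [//|av] := ltnP (dist b v) (dist a v); first by left.
have [//|cv] := ltnP (dist b v) (dist c v); first by right.
case: (@closer_neighbor_unique b a c v) => //.
by have := dist_adj_cases v ba; lia.
Qed.

(** An edge [b c] separates the tree into two halves, and it is the only edge
from one half to the other.  Parity forces [dist u b = dist w c]; were it
positive, [u] would have two neighbors closer to [c], namely [w] and the next
vertex towards [b]. *)
Lemma edge_crossing b c u w : adj b c -> adj u w ->
  dist b u < dist c u -> dist c w < dist b w -> u = b.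
Proof.
move=> bc uw bu cw; have wu : adj w u by rewrite adj_sym.
have e1 := dist_adj_cases u bc; have e2 := dist_adj_cases w bc.
have e3 := dist_adj_cases b uw; have e4 := dist_adj_cases c uw.
rewrite !(dist_sym _ b) !(dist_sym _ c) in e3 e4.
apply/eqP; apply/negP => /negP/eqP/dist_step[z uz dz].
rewrite ![dist _ b]dist_sym in dz.
have zc := dist_triangle b z c; rewrite (dist_sym z b) in zc.
have bc1 := adj_dist bc.
have [zw||] := @dist_branch z u w c uz uw; first by rewrite zw in dz; lia.
  by rewrite (dist_sym u c); lia.
by rewrite !(dist_sym _ c); lia.
Qed.

(** The first step of the geodesic from [x] to [y] is unique by [dist_branch],
so it is fixed together with [x] and [y]. *)
Lemma fix_subtree g : elliptic g -> subtree [set x | g x = x].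
Proof.
move=> [o oE]; split; first by exists o.
move=> x y /= gx gy; move: {2}(dist x y) (erefl (dist x y)) => n.
elim: n x gx => [|n IHn] x gx dn; first by exists [::]; rewrite (dist0 dn).
have [e|z xz dz] := @dist_step x y; first by rewrite e distxx in dn.
have gz : g z = z.
  apply/eqP/negP => /negP/eqP gz.
  have [||] := @dist_branch (g z) x z y _ xz gz.
  - by rewrite -{1}gx aut_adj.
  - by rewrite -{2}gy dist_aut; lia.
  - by lia.
have [|p [zp pl pS]] := IHn z gz; first by lia.
exists (z :: p); split=> //=; first by rewrite xz.
by move=> u; rewrite inE => /orP[/eqP ->|/pS].
Qed.

End TreeMetric.

(** * Attraction by an automorphism *)
Section Pointing.
Variable T : tree.
Implicit Types (x y z a b c u v w o : T) (g f : aut T).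

(** The first alternative says that the largest distance to a fixed vertex is
smaller at [b] than at [a], without requiring this maximum to exist. *)
Definition points g a b : Prop :=
  adj a b /\
  ((exists v, g v = v /\ forall w, g w = w -> dist b w < dist a v) \/
   ~ elliptic g /\ dist b (g a) < dist a (g a)).

Definition slim g : Prop := elliptic g -> ~ unbounded [set x | g x = x].

(** This equivariance lets conjugation by [f] act on the sets of automorphisms
defined by arrows through moving the edges by [f]. *)
Lemma points_conj f g a b :
  points (f^-1 * g * f)%g a b <-> points g (f a) (f b).
Proof.
have E v : (f^-1 * g * f)%g v = aut_inv f (g (f v)) by [].
have fE v : (f^-1 * g * f)%g v = v <-> g (f v) = f v.
  by rewrite E; split=> [{2}<-|->]; rewrite ?aut_invK ?aut_funK.
have eE : elliptic (f^-1 * g * f)%g <-> elliptic g.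
  split=> [[v /fE ?]|[v gv]]; first by exists (f v).
  by exists (aut_inv f v); apply/fE; rewrite aut_invK.
have dE u v : dist u ((f^-1 * g * f)%g v) = dist (f u) (g (f v)).
  by rewrite E -(dist_aut f) aut_invK.
rewrite /points aut_adj !dE eE; split=> -[ab [[v [vv H]]|H]]; split=> //;
  try by right.
  left; exists (f v); split; first exact/fE.
  move=> w gw; rewrite -(aut_invK f w) !dist_aut; apply: H; apply/fE.
  by rewrite aut_invK.
left; exists (aut_inv f v); split; first by apply/fE; rewrite aut_invK.
move=> w /fE/H; rewrite -{1}(aut_invK f v) !dist_aut.
by [].
Qed.

(** The radius [rho] of the fixed set seen from a vertex has no weak local
maximum on a path [a b c]: a fixed vertex farthest from [b] is even farther
from [a] or from [c], by [dist_branch]. *)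
Lemma slim_radius g : elliptic g -> slim g -> exists rho : T -> nat,
  (forall a b, points g a b <-> adj a b /\ rho b < rho a) /\
  (forall a b c, adj b a -> adj b c -> a <> c ->
    rho b < rho a \/ rho b < rho c).
Proof.
move=> eg /(_ eg)/existsNP[n nP]; have [o go] := eg.
have bd a v : g v = v -> dist a v <= dist a o + n.
  move=> gv; have := dist_triangle o a v; suff : dist o v <= n by lia.
  by rewrite leqNgt; apply/negP => lt; apply: nP; exists o, v.
have ex a : exists m, `[< exists v, g v = v /\ dist a v = m >].
  by exists (dist a o); apply/asboolP; exists o.
have ub a m : `[< exists v, g v = v /\ dist a v = m >] -> m <= dist a o + n.
  by move=> /asboolP[v [gv <-]]; exact: bd.
pose rho a := ex_maxn (ex a) (@ub a).
have rhoP a : (exists v, g v = v /\ dist a v = rho a) /\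
    forall v, g v = v -> dist a v <= rho a.
  rewrite /rho; case: ex_maxnP => m /asboolP mP mM; split=> // v gv.
  by apply: mM; apply/asboolP; exists v.
exists rho; split=> [a b|a b c ba bc ac].
  split=> [[ab]|[ab lt]]; last first.
    split=> //; left; have [[v [gv dv]] _] := rhoP a; exists v; split=> // w gw.
    by rewrite dv; apply: leq_ltn_trans lt; apply: (rhoP b).2.
  case=> [[v [gv H]]|[]//]; split=> //.
  have [[w [gw <-]] _] := rhoP b; have [_ /(_ _ gv)] := rhoP a.
  by apply: leq_trans; exact: H.
have [[v [gv <-]] _] := rhoP b; have [_ /(_ _ gv) va] := rhoP a.
have [_ /(_ _ gv) vc] := rhoP c.
by have := dist_branch v ba bc ac; lia.
Qed.

Lemma points_fixfree g : ~ elliptic g -> forall a b,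
  points g a b <-> adj a b /\ dist b (g a) < dist a (g a).
Proof.
move=> ng a b; split=> -[ab H]; split=> //; last by right.
by case: H => [[v [gv _]]|[]//]; case: ng; exists v.
Qed.

(** Otherwise [g a] lies on the side of [a] and [g b] on the side of [b], so
that the edge from [g a] to [g b] crosses the edge [a b] and [g a = a].
For an inversion of [a b] both arrows are present. *)
Lemma points_fixfree_total g a b : ~ elliptic g -> adj a b ->
  points g a b \/ points g b a.
Proof.
move=> ng ab; have ba : adj b a by rewrite adj_sym.
apply: contrapT => /not_orP[]; rewrite !points_fixfree // => na nb.
case: ng; exists a; apply: (@edge_crossing _ a b (g a) (g b)) => //.
- by rewrite aut_adj.
- have := dist_adj_cases (g a) ab.
  by case: (ltnP (dist b (g a)) (dist a (g a))) => [?|]; [case: na|lia].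
- have := dist_adj_cases (g b) ab.
  by case: (ltnP (dist a (g b)) (dist b (g b))) => [?|]; [case: nb|lia].
Qed.

(** Arrows against a path propagate: if [g] attracts [b] to [a], it attracts
everything behind [b] to [b].  In the absence of fixed vertices, failure at [c]
would put [g b] and [g c] on either side of the edge [b c], whence [g b = b]. *)
Lemma points_in g a b c : slim g ->
  points g b a -> adj b c -> a <> c -> points g c b.
Proof.
move=> sg; have [eg|ng] := pselect (elliptic g).
  have [rho [rhoP rhoQ]] := slim_radius eg sg.
  rewrite !rhoP => -[ba lt] bc ac; split; first by rewrite adj_sym.
  by have := rhoQ _ _ _ ba bc ac; lia.
rewrite !points_fixfree // => -[ba lt] bc ac.
split; first by rewrite adj_sym.
have lt' : dist b (g b) < dist c (g b).
  by have := dist_branch (g b) ba bc ac; lia.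
have [//|ge] := ltnP (dist b (g c)) (dist c (g c)).
case: ng; exists b; apply: (@edge_crossing _ b c (g b) (g c)) => //.
  by rewrite aut_adj.
by have := dist_adj_cases (g c) bc; lia.
Qed.

Lemma points_uniq g a b c : slim g -> points g a b -> points g a c -> b = c.
Proof.
move=> sg pb pc; apply/eqP/negP => /negP/eqP bc; move: pb pc.
have [eg|ng] := pselect (elliptic g).
  have [rho [rhoP rhoQ]] := slim_radius eg sg.
  by rewrite !rhoP => -[ab ?] [ac ?]; have := rhoQ _ _ _ ab ac bc; lia.
rewrite !points_fixfree // => -[ab ?] [ac ?].
by have := dist_branch (g a) ab ac bc; lia.
Qed.

(** The only neighbor of [b] that may fail to be sent to [b] is the one in the
direction of the attracting place.  The rule involves two edges because the
edge at the centre of the fixed subtree of an elliptic [g] may carry no arrow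
at all. *)
Lemma points_some g a b c : slim g -> adj b a -> adj b c -> a <> c ->
  points g a b \/ points g c b.
Proof.
move=> sg ba bc ac; have ab : adj a b by rewrite adj_sym.
have cb : adj c b by rewrite adj_sym.
have [eg|ng] := pselect (elliptic g).
  have [rho [rhoP rhoQ]] := slim_radius eg sg.
  by rewrite !rhoP; have [] := rhoQ _ _ _ ba bc ac; [left|right].
have [] := points_fixfree_total ng ab; first by left.
by move=> pba; right; apply: points_in pba _ _.
Qed.

(** Iterates [points_in] along the geodesic from [a] to [y], which starts away
from [b]. *)
Lemma points_propagate g a b z y : slim g -> points g a b ->
  dist a y < dist b y -> adj y z -> dist z a < dist y a -> points g y z.
Proof.
move=> sg ab; have [aab _] := ab.
move: {2}(dist z a) (erefl (dist z a)) => n.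
elim: n z y => [|n IHn] z y dz yb yz zy.
  rewrite (dist0 dz) in yz zy *.
  apply: points_in ab _ _ => //; first by rewrite adj_sym.
  by move=> e; rewrite e distxx in yb.
have [e|u zu du] := @dist_step _ z a; first by rewrite e distxx in dz.
have zb : dist a z < dist b z.
  have e1 := dist_adj_cases y aab; have e2 := dist_adj_cases b yz.
  have e3 := dist_adj_cases a yz; have e4 := dist_adj_cases z aab.
  move: yb zy e1 e2 e3 e4; rewrite !(dist_sym _ a) !(dist_sym _ b); lia.
apply: (@points_in g u z y) => //; last first.
- by move=> uy; rewrite uy in du; lia.
- by rewrite adj_sym.
- by apply: IHn; lia.
Qed.

(** The edges [a b] and [c d] lead out of the geodesic from [a] to [c] at its
two ends.  By propagation [g] also points from [c] back towards [a], and the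
arrow at [c] is unique.  For [a = c] the conclusion fails when [b = d]. *)
Lemma points_diverge g a b c d : slim g -> a <> c ->
  dist a c < dist b c -> dist c a < dist d a ->
  points g a b -> points g c d -> False.
Proof.
move=> sg ac acb cad ab cd.
have [//|z cz dz] := @dist_step _ c a; first exact: nesym.
have cz' : points g c z by apply: points_propagate ab _ _ _ => //; lia.
by move: cad; rewrite (points_uniq sg cd cz'); lia.
Qed.

End Pointing.

(** * Geodesic rays *)
Section Rays.
Variable T : tree.
Implicit Types (r : nat -> T) (c b : int -> T) (o : T) (g h : aut T).

Definition ray r : Prop := forall i j, dist (r i) (r (i + j)) = j.

Lemma geodesic_ray c (i : int) : geodesic c -> ray (fun n => c (i + n%:Z)%R).
Proof. by move=> cG m n; rewrite cG; lia. Qed.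

Lemma geodesic_opp c : geodesic c -> geodesic (fun i => c (- i)%R).
Proof. by move=> cG i j; rewrite cG; lia. Qed.

Lemma ray_adj r i : ray r -> adj (r i) (r i.+1).
Proof. by move=> rR; apply: dist1_adj; rewrite -addn1 rR. Qed.

Lemma ray_neq2 r i : ray r -> r i <> r i.+2.
Proof. by move=> rR e; have := rR i 2; rewrite addn2 -e distxx. Qed.

(** The edge [r 0 - r 1] may carry no arrow at all, so the backward arrows are
only guaranteed from the second edge on. *)
Lemma ray_points_back g r : slim g -> ray r -> ~ points g (r 0) (r 1) ->
  forall i, points g (r i.+2) (r i.+1).
Proof.
move=> sg rR n01; elim=> [|i IHi].
  have [||//|//|//] := @points_some _ g (r 0) (r 1) (r 2) sg.
  - by rewrite adj_sym; exact: ray_adj.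
  - exact: ray_adj.
  - exact: ray_neq2.
by apply: points_in IHi _ _; [|exact: ray_adj|exact: ray_neq2].
Qed.

(** Otherwise the distance to [o] would stay bounded along the ray. *)
Lemma ray_recedes r o n : ray r ->
  exists2 m, n <= m & dist (r m) o < dist (r m.+1) o.
Proof.
move=> rR; apply: contrapT => /forall2NP H.
have le k : dist (r (n + k)) o <= dist (r n) o.
  elim: k => [|k IHk]; first by rewrite addn0.
  have [|/negP] := H (n + k); first by lia.
  by rewrite addnS; lia.
have := dist_triangle o (r n) (r (n + (dist (r n) o).*2.+1)).
have := le (dist (r n) o).*2.+1; rewrite rR (dist_sym o); lia.
Qed.

(** Beyond [n] the ray leaves the line [b] for good, so an edge of the ray that
recedes from [b 0] has all of [b] behind it: to get to the other side, [b] would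
have to cross this edge, and hence to contain [r m]. *)
Lemma ray_exits r b n : ray r -> geodesic b ->
  (forall i, n <= i -> ~ range b (r i)) ->
  exists2 m, ~ range b (r m) & forall j, dist (r m) (b j) < dist (r m.+1) (b j).
Proof.
move=> rR bG rb; have [m nm mP] := ray_recedes (b 0%R) n rR.
exists m; first exact: rb.
(* The two halves of b are rays s from b 0, followed step by step. *)
have side (s : nat -> T) : ray s -> (forall i, range b (s i)) -> s 0 = b 0%R ->
    forall i, dist (r m) (s i) < dist (r m.+1) (s i).
  move=> sR sb s0; elim=> [|i IHi]; first by rewrite s0.
  have [//|ge] := ltnP (dist (r m) (s i.+1)) (dist (r m.+1) (s i.+1)).
  case: (rb m nm); suff <- : s i = r m by [].
  apply: (@edge_crossing _ _ (r m.+1) _ (s i.+1)) => //.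
  - exact: ray_adj.
  - exact: ray_adj.
  - by have := dist_adj_cases (s i.+1) (ray_adj m rR); lia.
have pos := side _ (geodesic_ray 0%R bG).
have neg := side _ (geodesic_ray 0%R (geodesic_opp bG)).
have [posP negP] : (forall i, range b (b (0 + i%:Z)%R)) /\
  (forall i, range b (b (- (0 + i%:Z))%R)) by split=> i; eexists.
case=> i; first by have := pos posP erefl i; rewrite GRing.add0r.
have := neg negP erefl i.+1; rewrite GRing.add0r NegzE; exact.
Qed.

End Rays.

(** * Segments on an axis *)
Section Axes.
Variable T : tree.
Implicit Types (c b : int -> T) (g h : aut T) (m n : nat).

Lemma finite_preimage_geodesic c (F : set T) : geodesic c -> finite_set F ->
  exists n, forall i : int, F (c i) -> `|i|%N < n.
Proof.
move=> cG /finite_seqP[s ->].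
exists (\max_(v <- s) dist (c 0%R) v).+1 => i /= si.
rewrite ltnS; apply: leq_trans (leq_bigmax_seq _ si isT).
by rewrite cG; lia.
Qed.

Lemma geodesic_exits c b : geodesic c -> geodesic b ->
  finite_set (range c `&` range b) ->
  exists2 m : nat, ~ range b (c m) &
    forall j, dist (c m) (b j) < dist (c (m%:Z + 1)%R) (b j).
Proof.
move=> cG bG /(finite_preimage_geodesic cG)[n nP].
have [|m mb mP] := @ray_exits _ _ b n (geodesic_ray 0%R cG) bG.
  move=> i ni bi; suff : `|(0 + i%:Z)%R|%N < n by lia.
  by apply: nP; split=> //; eexists.
exists m; first by rewrite GRing.add0r in mb.
move=> j; have := mP j; rewrite !GRing.add0r.
by have -> : (m%:Z + 1)%R = m.+1 by lia.
Qed.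

(** The segment runs from [c (- n)] to [c m]; two natural numbers parametrize
it because its extremities are found on the two opposite rays from [c 0]. *)
Definition confined c m n g : Prop :=
  ~ points g (c m) (c (m%:Z + 1)%R) /\
  ~ points g (c (- n%:Z)%R) (c (- (n%:Z + 1))%R).

(** The segment and its translate by [s] are disjoint and separated by two
edges at least.  Beyond the first segment, [g] points back at every later edge
by [ray_points_back], in particular at the first extremity of the second
segment, where this is the outward direction. *)
Lemma confined_translate c m n (s : nat) g h : geodesic c -> slim g ->
  (forall i, h (c i) = c (i + s%:Z)%R) -> m + n + 2 <= s ->
  confined c m n g -> confined c m n (h^-1 * g * h)%g -> False.
Proof.
move=> cG sg hc ms [gm _] [_]; apply; apply/points_conj; rewrite !hc.
have := ray_points_back sg (geodesic_ray m%:Z cG) _ (s - (m + n + 2)).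
have -> : (m%:Z + 0 = m)%R by lia.
move=> /(_ gm).
have -> : (m%:Z + (s - (m + n + 2)).+2%:Z = - n%:Z + s%:Z)%R by lia.
by have -> : (m%:Z + (s - (m + n + 2)).+1%:Z = - (n%:Z + 1) + s%:Z)%R by lia.
Qed.

(** The axis can be parametrized so that [h] translates in the positive
direction; powers of [h] then provide arbitrarily large translations. *)
Lemma axis_translations (Gamma : groupClosed (aut T)) h A :
  h \in Gamma -> is_axis h A ->
  exists c, [/\ geodesic c, A = range c & forall N, exists g s,
    [/\ g \in Gamma, N <= s & forall i, g (c i) = c (i + s%:Z)%R]].
Proof.
have pos c f (k : nat) : f \in Gamma -> (0 < k) ->
    (forall i, f (c i) = c (i + k%:Z)%R) ->
    forall N, exists g s, [/\ g \in Gamma, N <= s &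
      forall i, g (c i) = c (i + s%:Z)%R].
  move=> fG k0 fc; elim=> [|N [g [s [gG Ns gc]]]].
    exists 1%g, 0; split=> //; first exact: gpred1.
    by move=> i; rewrite GRing.addr0.
  exists (f * g)%g, (s + k); split; [exact: gpredM|lia|].
  by move=> i; rewrite /= gc fc PoszD GRing.addrA.
move=> hG [c [cG -> [k k0 hc]]]; have [kp|kn] := Num.Theory.ltrP 0%R k.
  exists c; split=> //; apply: (pos _ h `|k|%N) => //; first by lia.
  by move=> i; rewrite hc; congr c; lia.
exists (fun i => c (- i)%R); split; first exact: geodesic_opp.
  apply/seteqP; split=> _ [i _ <-]; exists (- i)%R => //.
  by rewrite GRing.opprK.
apply: (pos _ h `|k|%N) => //; first by lia.
by move=> i; rewrite hc; congr c; lia.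
Qed.

End Axes.

(** * Invariant means *)
Section Mean.
Variables (R : realType) (G : groupType).
Implicit Types P Q : set (nontrivial G).
Local Open Scope ring_scope.
Import Order.TTheory GRing.Theory Num.Theory.

Lemma indicator_subproof P :
  (fun x => `[< P x >]%:R : R[i]) \in @linf_pred R (nontrivial G).
Proof.
apply/linf_predP; exists 1; split; first exact: real1.
by move=> x; case: `[< _ >]; rewrite ?normr1 ?normr0 ?ler01.
Qed.

Definition indicator P : linf R (nontrivial G) := Linf (indicator_subproof P).

(** The set [P], its conjugate by [g] and its conjugate by the square of [g] are
pairwise disjoint; disjointness of the last two is a conjugate of that of the
first two. *)
Definition disjoint_conjugates P : Prop := exists g : G, forall x,
  ~ (P x /\ P (inner g^-1%g x)) /\
  ~ (P x /\ P (inner g^-1%g (inner g^-1%g x))).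

Variable m : {linear linf R (nontrivial G) -> R[i]^o}.
Hypothesis m_ge0 : forall f : linf R (nontrivial G),
  (forall x, 0 <= f x) -> 0 <= m f :> R[i].
Hypothesis m1 : m (linf_cst (nontrivial G) 1) = 1.
Hypothesis m_inner : forall (g : G) (f : linf R (nontrivial G)),
  m (linf_comp f (inner g^-1%g)) = m f.

Lemma mean_le (f f' : linf R (nontrivial G)) :
  (forall x, f x <= f' x) -> m f <= m f' :> R[i].
Proof.
move=> ff'; rewrite -subr_ge0.
have -> : m f' - m f = m (f' - f) by rewrite linearB.
by apply: m_ge0 => x; change (0 <= f' x - f x); rewrite subr_ge0.
Qed.

Lemma disjoint_conjugates_mean P : disjoint_conjugates P ->
  m (indicator P) *+ 3 <= 1 :> R[i].
Proof.
move=> [g gP]; pose f := linf_comp (indicator P) (inner g^-1%g).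
pose f' := linf_comp f (inner g^-1%g).
have <- : m (indicator P + f + f') = m (indicator P) *+ 3.
  have fE : m f = m (indicator P) by exact: m_inner.
  have f'E : m f' = m f by exact: m_inner.
  by rewrite 2!linearD f'E fE -mulr2n -mulrSr.
rewrite -m1; apply: mean_le => x.
change (`[< P x >]%:R + `[< P (inner g^-1%g x) >]%:R
  + `[< P (inner g^-1%g (inner g^-1%g x)) >]%:R <= 1 :> R[i]).
have [n1 n2] := gP x; have [n3 _] := gP (inner g^-1%g x).
rewrite -!natrD lern1.
by do 3![case: asboolP => ?] => //; exfalso; tauto.
Qed.

(** A cover by two sets of mean at most 1/3 would give [3 <= 2]. *)
Lemma disjoint_conjugates_cover P Q :
  disjoint_conjugates P -> disjoint_conjugates Q ->
  ~ forall x, P x \/ Q x.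
Proof.
move=> /disjoint_conjugates_mean tP /disjoint_conjugates_mean tQ PQ.
have : m (linf_cst (nontrivial G) 1) <= m (indicator P + indicator Q) :> R[i].
  apply: mean_le => x.
  change (1 <= `[< P x >]%:R + `[< Q x >]%:R :> R[i]).
  rewrite -natrD ler1n.
  by have := PQ x; do 2![case: asboolP => ?] => // -[].
rewrite m1 linearD => le.
have : 3%:R <= 2%:R :> R[i].
  apply: le_trans (lerD tP tQ); rewrite -mulrnDl.
  by rewrite lerMn2r.
by rewrite ler_nat.
Qed.

End Mean.

(** * Transverse axes exclude an invariant mean *)
Lemma subgroup_val_neq1 (G : groupType) (H : groupClosed G)
  (x : nontrivial (subgroup_type H)) : subgroup_val (nt_val x) != 1%g.
Proof.
by apply: contra (nt_valP x) => /eqP e; apply/eqP; apply: val_inj; exact: e.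
Qed.

Lemma confined_disjoint_conjugates (T : tree) (Gamma : groupClosed (aut T))
    (c : int -> T) (m n : nat) : geodesic c ->
  (forall N, exists g s,
    [/\ g \in Gamma, N <= s & forall i, g (c i) = c (i + s%:Z)%R]) ->
  (forall g, g \in Gamma -> g != 1%g -> slim g) ->
  disjoint_conjugates [set x : nontrivial (subgroup_type Gamma) |
    confined c m n (subgroup_val (nt_val x))].
Proof.
move=> cG /(_ (m + n + 2))[g [s [gG ms gc]]] slimG.
exists (Subgroup gG) => x /=.
have sx : slim (subgroup_val (nt_val x)).
  by apply: slimG; [exact: subgroup_valP|exact: subgroup_val_neq1].
have E y : subgroup_val (nt_val (inner (Subgroup gG)^-1%g y)) =
    (g^-1 * subgroup_val (nt_val y) * g)%g.
  transitivity (g^-1 * subgroup_val (nt_val y) * g^-1^-1)%g; first by [].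
  by rewrite invgK.
have ggc i : (g * g)%g (c i) = c (i + (s + s)%:Z)%R.
  by rewrite /= !gc PoszD GRing.addrA.
split=> -[x0 x1].
  by apply: (confined_translate cG sx gc ms x0); rewrite -E; exact: x1.
apply: (confined_translate cG sx ggc _ x0); first by lia.
have -> y : ((g * g)^-1 * y * (g * g) = g^-1 * (g^-1 * y * g) * g)%g.
  by rewrite invgM !mulgA.
by rewrite -!E; exact: x1.
Qed.

Theorem proposition0p3 (R : realType) (T : tree) (Gamma : groupClosed (aut T))
  (Gamma_countable : countable [set` Gamma])
  (Gamma_transverse : exists g h : aut T,
      [/\ g \in Gamma, h \in Gamma & transverse g h])
  (Gamma_inner_amenable : inner_amenable R (subgroup_type Gamma)) :
  exists g : aut T, [/\ g \in Gamma, g != 1%g, elliptic g &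
    exists S : set T, [/\ subtree S, unbounded S & fixes g S]].
Proof.
apply: contrapT => noS.
have slimG g : g \in Gamma -> g != 1%g -> slim g.
  move=> gG g1 eg ug; apply: noS; exists g; split=> //.
  by exists [set x | g x = x]; split=> //; exact: fix_subtree.
have [g [h [gG hG [[A gA] [B hB] AB]]]] := Gamma_transverse.
have {AB} := AB _ _ gA hB.
have [a [aG -> aT]] := axis_translations gG gA.
have [b [bG -> bT]] := axis_translations hG hB => fab.
have [triv|[m [m_ge0 m1 m_inner]]] := Gamma_inner_amenable.
  have [f [s [fG s1 fa]]] := aT 1.
  have f1 : f = 1%g by exact: (congr1 (@subgroup_val _ _) (triv (Subgroup fG))).
  by have := aG 0%R (Posz s); have := fa 0%R; rewrite f1 /= GRing.add0r => <-;
    rewrite distxx; lia.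
(* The lower extremity of a segment is the upper one for the reversed axis. *)
have opp_range c : range (fun i : int => c (- i)%R : T) = range c.
  apply/seteqP; split=> _ [i _ <-]; exists (- i)%R => //.
  by rewrite GRing.opprK.
have fba : finite_set (range b `&` range a) by rewrite setIC.
have [p1 p1b p1P] := geodesic_exits aG bG fab.
have [p2 p2b p2P] : exists2 n : nat, ~ range b (a (- n%:Z)%R) & forall j,
    dist (a (- n%:Z)%R) (b j) < dist (a (- (n%:Z + 1))%R) (b j).
  by apply: (geodesic_exits (geodesic_opp aG) bG); rewrite opp_range.
have [q1 q1a q1P] := geodesic_exits bG aG fba.
have [q2 q2a q2P] : exists2 n : nat, ~ range a (b (- n%:Z)%R) & forall j,
    dist (b (- n%:Z)%R) (a j) < dist (b (- (n%:Z + 1))%R) (a j).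
  by apply: (geodesic_exits (geodesic_opp bG) aG); rewrite opp_range.
apply: (disjoint_conjugates_cover m_ge0 m1 m_inner
  (confined_disjoint_conjugates p1 p2 aG aT slimG)
  (confined_disjoint_conjugates q1 q2 bG bT slimG)) => x /=.
set f := subgroup_val _.
have sf : slim f.
  by apply: slimG; [exact: subgroup_valP|exact: subgroup_val_neq1].
have neq i j : ~ range b (a i) -> a i <> b j by move=> n e; apply: n; exists j.
apply: contrapT => /not_orP[/not_andP[]/contrapT ap /not_andP[]/contrapT bq];
  by apply: (points_diverge sf _ _ _ ap bq) => //; exact: neq.
Qed.
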